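(* Let $\mathsf{D}_{\mathrm{ET}}$ be a regular Entropy-Transport distance induced by $(a,F,\ell)$, with induced Sturm-Entropy-Transport distance $\mathbf{D}_{\mathrm{ET}}$. A sequence of metric measure spaces $(X_n,d_n,\mu_n)_{n\in\mathbb{N}}$ weakly measured-Gromov converges to a metric measure space $(X_\infty,d_\infty,\mu_\infty)$ if and only if $$\mathbf{D}_{\mathrm{ET}}\big((X_n,d_n,\mu_n),(X_\infty,d_\infty,\mu_\infty)\big)\to 0\quad\text{as } n\to\infty.$$
   Context: For a complete separable metric space $X$, $\mathscr{M}(X)$ denotes the set of finite nonnegative Borel measures on $X$, endowed with the weak topology (duality with bounded continuous functions). $\Gamma_0(\mathbb{R}_+)$ is the set of convex, lower semicontinuous $F:[0,\infty)\to[0,\infty]$ with $F(1)=0$; $F'_\infty:=\lim_{s\to\infty}F(s)/s$, and $F$ is superlinear if $F'_\infty=+\infty$. The $F$-divergence is $D_F(\gamma\|\mu):=\int_X F(\sigma)\,d\mu+F'_\infty\,\gamma^\perp(X)$, where $\gamma=\sigma\mu+\gamma^\perp$ is the Lebesgue decomposition of $\gamma$ with respect to $\mu$ (with $\infty\cdot 0=0$). The Entropy-Transport cost induced by $F$ and a lower semicontinuous cost $c:X\times X\to[0,\infty]$ is $$\mathrm{ET}(\mu_1,\mu_2):=\inf_{\gamma\in\mathscr{M}(X\times X)}\Big\{D_F(\gamma_1\|\mu_1)+D_F(\gamma_2\|\mu_2)+\int_{X\times X} c\,d\gamma\Big\},$$ where $\gamma_i=(\pi^i)_\sharp\gamma$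 are the marginals of $\gamma$. Regular Entropy-Transport distance induced by $(a,F,\ell)$: here $a\in(0,1]$, $F\in\Gamma_0(\mathbb{R}_+)$ is superlinear and finite valued, $\ell:[0,\infty)\to[0,\infty]$ is continuous, convex, with $\ell(s)=0$ iff $s=0$; for every complete separable metric space $(X,d)$ one sets $\mathsf{D}_{\mathrm{ET}}:=\mathrm{ET}^a$ on $\mathscr{M}(X)$, with $\mathrm{ET}$ induced by $F$ and $c(x_1,x_2)=\ell(d(x_1,x_2))$, and it is required that, for every complete separable metric space $(X,d)$, $\mathsf{D}_{\mathrm{ET}}$ is a complete and separable metric on $\mathscr{M}(X)$ inducing the weak topology. A metric measure space is a triple $(X,d,\mu)$ with $(X,d)$ a complete separable metric space and $\mu\in\mathscr{M}(X)$; $\mathsf{supp}(\mu)$ is the support of $\mu$. Metric measure spaces are identified when isomorphic, i.e. when there is an isometry $\psi:\mathsf{supp}(\mu_1)\to\mathsf{supp}(\mu_2)$ with $\psi_\sharp\mu_1=\mu_2$. The Sturm-Entropy-Transport distance is $$\mathbf{D}_{\mathrm{ET}}\big((X_1,d_1,\mu_1),(X_2,d_2,\mu_2)\big):=\inf\ \mathsf{D}_{\mathrm{ET}}(\psi^1_\sharp\mu_1,\psi^2_\sharp\mu_2),$$ the infimum over all complete separable metric spaces $(\hat X,\hat d)$ and isometric embeddings $\psi^i:\mathsf{supp}(\mu_i)\to\hat X$, $i=1,2$ (with $\mathsf{D}_{\mathrm{ET}}$ computed in $(\hat X,\hat d)$). Weak measured-Gromov convergence: $(X_n,d_n,\mu_n)_{n\in\mathbb{N}}$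 weakly measured-Gromov converges to $(X_\infty,d_\infty,\mu_\infty)$ if there exist a complete separable metric space $(X,d)$ and isometric embeddings $\iota_n:X_n\to X$, $n\in\mathbb{N}\cup\{\infty\}$, such that $(\iota_n)_\sharp\mu_n\to(\iota_\infty)_\sharp\mu_\infty$ weakly in $\mathscr{M}(X)$. *)

(* Defs.v *)
From HB Require Import structures.
From mathcomp Require Import all_boot all_order all_algebra.
From mathcomp Require Import all_classical all_reals all_analysis.

Set Implicit Arguments.
Unset Strict Implicit.
Unset Printing Implicit Defensive.

Import Order.TTheory GRing.Theory Num.Theory.
Import numFieldTopology.Exports numFieldNormedType.Exports.

Local Open Scope classical_set_scope.
Local Open Scope ring_scope.

(* Complete separable metric spaces. Both completeType and measurableType are
   pointed in the library, so these spaces are nonempty. *)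
HB.mixin Record isSeparable T & Topological T := {
  separable : exists2 S : set T, countable S & dense S }.

#[short(type="polishMetricType")]
HB.structure Definition PolishMetric (R : numDomainType) :=
  { T of Metric R T & Complete T & isSeparable T }.

Definition isometric_embedding (R : realType) (X Y : metricType R)
  (f : X -> Y) := forall x y, mdist (f x) (f y) = mdist x y.

Section metric_subtype.
Context (R : realType) (X : metricType R) (A : set X).

Let dist (x y : A) : R := mdist (set_val x) (set_val y).

Let dist_ge0 x y : 0 <= dist x y. Proof. exact: mdist_ge0. Qed.

Let dist_positivity x y : dist x y = 0 -> x = y.
Proof. by move=> /mdist_positivity /val_inj. Qed.

Let ballEdist (x : A) d : ball x d = [set y | dist x y < d].
Proof.
by apply/seteqP; split=> y; rewrite /ball /= /initial_ball ballEmdist.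
Qed.

HB.instance Definition _ :=
  @PseudoMetric_isMetric.Build R A dist dist_ge0 dist_positivity ballEdist.

End metric_subtype.

Lemma isometric_continuous (R : realType) (X Y : metricType R) (f : X -> Y) :
  isometric_embedding f -> continuous f.
Proof.
move=> fi x; apply/metricType_numDomainType.cvgrPdist_lt => e e0.
by apply/metricType_numDomainType.nbhs_mdistP; exists e => // y /=; rewrite fi.
Qed.

HB.instance Definition _ (X Y : ptopologicalType) :=
  Topological.on (X * Y)%type.

Definition borel (X : ptopologicalType) := g_sigma_algebraType (@open X).

HB.instance Definition _ (X : ptopologicalType) := Measurable.on (borel X).

(* Library measures are functions on all subsets, constrained on measurable
   ones only: two elements of [finmeas R X] are the same Borel measure iff they
   agree on Borel sets. *)
Definition finmeas (R : realType) (X : ptopologicalType) : Type :=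
  {finite_measure set (borel X) -> \bar R}.

HB.instance Definition _ (R : realType) (X : ptopologicalType) :=
  gen_eqMixin (finmeas R X).
HB.instance Definition _ (R : realType) (X : ptopologicalType) :=
  gen_choiceMixin (finmeas R X).

Definition bounded_continuous (R : realType) (X : topologicalType) : Type :=
  {f : X -> R | continuous f /\ exists M : R, forall x, `|f x| <= M}.

HB.instance Definition _ (R : realType) (X : topologicalType) :=
  gen_eqMixin (bounded_continuous R X).
HB.instance Definition _ (R : realType) (X : topologicalType) :=
  gen_choiceMixin (bounded_continuous R X).

Definition duality (R : realType) (X : ptopologicalType) (mu : finmeas R X) :
    prod_topology (fun _ : bounded_continuous R X => R) :=
  fun f => (\int[mu]_x (sval f x))%R.

(* The weak topology of M(X): the coarsest one making mu |-> \int f dmu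
   continuous for every bounded continuous f. *)
HB.instance Definition _ (R : realType) (X : ptopologicalType) :=
  Topological.copy (finmeas R X) (initial_topology (@duality R X)).

Lemma borel_measurable_continuous (X Y : ptopologicalType) (f : X -> Y) :
  continuous f -> measurable_fun [set: borel X] (f : borel X -> borel Y).
Proof.
move=> /continuousP cf; apply: (@measurability _ _ (borel X) (borel Y) _ _ (@open Y)) => //.
by move=> _ [U oU <-]; rewrite setTI; apply: sub_sigma_algebra; exact: cf.
Qed.

Section pushforward_continuous.
Local Open Scope ereal_scope.
Context (R : realType) (X Y : ptopologicalType) (f : X -> Y).

Definition push_fun (cf : continuous f) (mu : finmeas R X) :
  set (borel Y) -> \bar R :=
  pushforward (mu : set (borel X) -> \bar R) (f : borel X -> borel Y).

Variables (cf : continuous f) (mu : finmeas R X).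
Local Notation nu := (push_fun cf mu).
Let mf := borel_measurable_continuous cf.

Let nu0 : nu set0 = 0.
Proof. by rewrite /push_fun /pushforward preimage_set0 measure0. Qed.

Let nu_ge0 B : 0 <= nu B. Proof. exact: measure_ge0. Qed.

Let nu_sigma_additive : semi_sigma_additive nu.
Proof.
move=> G mG tG mUG; rewrite /push_fun /pushforward preimage_bigcup.
apply: measure_semi_sigma_additive.
- by move=> n; rewrite -[X in measurable X]setTI; exact: mf.
- apply/trivIsetP => /= i j _ _ ij; rewrite -preimage_setI.
  by move/trivIsetP : tG => /(_ _ _ _ _ ij) ->//; rewrite preimage_set0.
- by rewrite -preimage_bigcup -[X in measurable X]setTI; exact: mf.
Qed.

HB.instance Definition _ := isMeasure.Build _ _ _ nu nu0 nu_ge0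
  nu_sigma_additive.

Let nu_fin : fin_num_fun nu.
Proof.
move=> B mB; apply: fin_num_measure.
by rewrite -[X in measurable X]setTI; exact: mf.
Qed.

HB.instance Definition _ := @Measure_isFinite.Build _ _ _ nu nu_fin.

End pushforward_continuous.

Definition push (R : realType) (X Y : ptopologicalType) (f : X -> Y)
  (cf : continuous f) (mu : finmeas R X) : finmeas R Y := push_fun cf mu.

Definition supp (R : realType) (X : ptopologicalType) (mu : finmeas R X) :
  set X := [set x | forall U : set X, open_nbhs x U -> (0 < mu U)%E].

Lemma closed_supp (R : realType) (X : ptopologicalType) (mu : finmeas R X) :
  closed (supp mu).
Proof.
rewrite -openC openE => x /= /existsNP[U /not_implyP[xU U0]].
rewrite /interior nbhsE; exists U => // y Uy yS; apply: U0; apply: yS.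
by split => //; case: xU.
Qed.

Section pushforward_support.
Local Open Scope ereal_scope.
Context (R : realType) (X Y : ptopologicalType) (mu : finmeas R X).
Variables (f : supp mu -> Y).

(* f is only defined on the support, whence the direct image of the preimage
   under the inclusion of the support in X. *)
Definition push_supp_fun (cf : continuous f) : set (borel Y) -> \bar R :=
  fun B => mu (set_val @` (f @^-1` B)).

Variable cf : continuous f.
Local Notation nu := (push_supp_fun cf).
Local Notation pre := (fun B : set Y => set_val @` (f @^-1` B) : set X).

Let pre_bigcup (F : (set Y)^nat) :
  pre (\bigcup_i F i) = \bigcup_i pre (F i).
Proof. by rewrite -image_bigcup -preimage_bigcup. Qed.

Let msupp : measurable (supp mu : set (borel X)).
Proof.
rewrite -[supp mu]setCK; apply: measurableC; apply: sub_sigma_algebra.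
by rewrite openC; exact: closed_supp.
Qed.

Let mpre (B : set (borel Y)) :
  measurable B -> measurable (pre B : set (borel X)).
Proof.
move: B; apply: (@smallest_sub _ _ _
  [set B | measurable (pre B : set (borel X))]).
  split => /=.
  - by rewrite preimage_set0 image_set0; exact: measurable0.
  - move=> B mB; rewrite setTD.
    suff -> : pre (~` B) = supp mu `\` pre B by exact: measurableD.
    apply/seteqP; split=> [_ [x nBx <-]|x [sx nBx]].
      split; first exact: set_valP.
      by move=> [y By /val_inj yx]; apply: nBx; rewrite -yx.
    exists (exist _ x (mem_set sx)) => //= Bx; apply: nBx.
    by exists (exist _ x (mem_set sx)).
  - by move=> F mF; rewrite pre_bigcup; exact: bigcupT_measurable.
move=> U oU /=; have /continuousP/(_ _ oU)[W oW WU] := cf.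
suff -> : pre U = W `&` supp mu.
  by apply: measurableI => //; exact: sub_sigma_algebra.
rewrite -WU; apply/seteqP; split=> [_ [x Wx <-]|x [Wx sx]].
  by split=> //; exact: set_valP.
by exists (exist _ x (mem_set sx)).
Qed.

Let nu0 : nu set0 = 0.
Proof. by rewrite /push_supp_fun preimage_set0 image_set0 measure0. Qed.

Let nu_ge0 B : 0 <= nu B. Proof. exact: measure_ge0. Qed.

Let nu_sigma_additive : semi_sigma_additive nu.
Proof.
move=> G mG tG mUG; rewrite /push_supp_fun pre_bigcup.
apply: measure_semi_sigma_additive.
- by move=> n; exact: mpre.
- apply/trivIsetP => /= i j _ _ ij.
  rewrite -subset0 => _ [[x Gix <-] [y Gjy /val_inj yx]].
  rewrite yx in Gjy; move/trivIsetP : tG => /(_ _ _ I I ij).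
  by rewrite -subset0 => /(_ (f x)); apply; split.
- by rewrite -pre_bigcup; exact: mpre.
Qed.

HB.instance Definition _ := isMeasure.Build _ _ _ nu nu0 nu_ge0
  nu_sigma_additive.

Let nu_fin : fin_num_fun nu.
Proof. by move=> B mB; apply: fin_num_measure; exact: mpre. Qed.

HB.instance Definition _ := @Measure_isFinite.Build _ _ _ nu nu_fin.

End pushforward_support.

Definition push_supp (R : realType) (X Y : ptopologicalType)
  (mu : finmeas R X) (f : supp mu -> Y) (cf : continuous f) : finmeas R Y :=
  push_supp_fun cf.

Section entropy_transport.
Local Open Scope ereal_scope.
Context (R : realType).

(* Functions on [0, +oo[ are represented by functions on R whose values at
   negative reals are irrelevant. *)
Definition convex_nonneg (F : R -> \bar R) :=
  forall s t u : R, (0 <= s)%R -> (0 <= t)%R -> (0 <= u <= 1)%R ->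
    F ((1 - u) * s + u * t)%R <= (1 - u)%:E * F s + u%:E * F t.

Record entropy_function (F : R -> \bar R) : Prop := EntropyFunction {
  entropy_ge0 : forall s, (0 <= s)%R -> 0 <= F s ;
  entropy_convex : convex_nonneg F ;
  entropy_lsc :
    lower_semicontinuous (F : subspace (`[0%R, +oo[ : set R) -> \bar R) ;
  entropy1 : F 1%R = 0 }.

Definition recession (F : R -> \bar R) : \bar R :=
  lim (F s * s^-1%:E @[s --> +oo%R]).

Definition superlinear (F : R -> \bar R) := recession F = +oo.

Definition lebesgue_decomposition (X : ptopologicalType)
    (gamma mu : finmeas R X) (sigma : X -> R) (gammaS : finmeas R X) :=
  [/\ measurable_fun [set: borel X] (sigma : borel X -> R),
      forall x, (0 <= sigma x)%R,
      exists2 N : set (borel X), measurable N & mu N = 0 /\ gammaS (~` N) = 0 &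
      forall A : set (borel X), measurable A ->
        gamma A = \int[mu]_(x in A) (sigma x)%:E + gammaS A].

(* The Lebesgue decomposition exists and is unique (sigma up to mu-null sets,
   gammaS on Borel sets), so the set below is a singleton and xget picks its
   element. In the library's arithmetic +oo * 0 = 0. *)
Definition divergence (F : R -> \bar R) (X : ptopologicalType)
    (gamma mu : finmeas R X) : \bar R :=
  xget +oo [set v | exists sigma gammaS,
    lebesgue_decomposition gamma mu sigma gammaS /\
    v = \int[mu]_x F (sigma x) + recession F * gammaS [set: X]].

Definition marginal1 (X : ptopologicalType)
    (gamma : finmeas R (X * X)%type) : finmeas R X :=
  push (f := fst) (fun x => cvg_fst) gamma.

Definition marginal2 (X : ptopologicalType)
    (gamma : finmeas R (X * X)%type) : finmeas R X :=
  push (f := snd) (fun x => cvg_snd) gamma.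

Definition ET (F : R -> \bar R) (X : ptopologicalType) (c : X * X -> \bar R)
    (mu1 mu2 : finmeas R X) : \bar R :=
  ereal_inf (range (fun gamma : finmeas R (X * X)%type =>
    divergence F (marginal1 gamma) mu1 + divergence F (marginal2 gamma) mu2
    + \int[gamma]_p c p)).

Definition DET (a : R) (F l : R -> \bar R) (X : polishMetricType R)
    (mu1 mu2 : finmeas R X) : \bar R :=
  poweR (ET F (fun p : X * X => l (mdist p.1 p.2)) mu1 mu2) a.

Record metric_on_measures (X : ptopologicalType)
    (D : finmeas R X -> finmeas R X -> \bar R) : Prop := MetricOnMeasures {
  D_fin : forall mu nu, D mu nu \is a fin_num ;
  D_ge0 : forall mu nu, 0 <= D mu nu ;
  D_eq0 : forall mu nu, D mu nu = 0 <->
    forall A : set (borel X), measurable A -> mu A = nu A ;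
  D_sym : forall mu nu, D mu nu = D nu mu ;
  D_triangle : forall mu nu xi, D mu xi <= D mu nu + D nu xi }.

Definition complete_distance (M : Type) (D : M -> M -> \bar R) :=
  forall u : nat -> M,
    (forall e : R, (0 < e)%R -> exists N : nat, forall m n : nat,
      (N <= m)%N -> (N <= n)%N -> D (u m) (u n) < e%:E) ->
    exists x : M, D (u n) x @[n --> \oo] --> 0.

Definition separable_distance (M : Type) (D : M -> M -> \bar R) :=
  exists2 S : set M, countable S &
    forall (x : M) (e : R), (0 < e)%R -> exists2 y, S y & D x y < e%:E.

Definition induces_topology (M : topologicalType) (D : M -> M -> \bar R) :=
  forall (x : M) (A : set M),
    nbhs x A <-> exists2 e : R, (0 < e)%R & [set y | D x y < e%:E] `<=` A.

Record regular_ET (a : R) (F l : R -> \bar R) : Prop := RegularET {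
  regular_exponent : (0 < a <= 1)%R ;
  regular_entropy : entropy_function F ;
  regular_superlinear : superlinear F ;
  regular_finite : forall s, (0 <= s)%R -> F s \is a fin_num ;
  regular_cost_ge0 : forall s, (0 <= s)%R -> 0 <= l s ;
  regular_cost_continuous : {within (`[0%R, +oo[ : set R), continuous l} ;
  regular_cost_convex : convex_nonneg l ;
  regular_cost_eq0 : forall s, (0 <= s)%R -> l s = 0 <-> s = 0%R ;
  regular_metric : forall X : polishMetricType R,
    [/\ metric_on_measures (@DET a F l X),
        complete_distance (@DET a F l X),
        separable_distance (@DET a F l X) &
        @induces_topology (finmeas R X) (@DET a F l X)] }.

End entropy_transport.

Record mmspace (R : realType) := MMSpace {
  mm_space :> polishMetricType R ;
  mm_measure : finmeas R mm_space }.

Definition SturmET (R : realType) (a : R) (F l : R -> \bar R)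
    (X1 X2 : mmspace R) : \bar R :=
  ereal_inf [set r | exists (Y : polishMetricType R)
    (psi1 : supp (mm_measure X1) -> Y) (psi2 : supp (mm_measure X2) -> Y)
    (h1 : isometric_embedding psi1) (h2 : isometric_embedding psi2),
    r = DET a F l (push_supp (isometric_continuous h1))
                  (push_supp (isometric_continuous h2))].

Definition weak_mG_cvg (R : realType) (X : nat -> mmspace R)
    (Xoo : mmspace R) : Prop :=
  exists (Y : polishMetricType R)
    (iota : forall n, X n -> Y) (iotaoo : Xoo -> Y)
    (h : forall n, isometric_embedding (iota n))
    (hoo : isometric_embedding iotaoo),
    push (isometric_continuous (h n)) (mm_measure (X n)) @[n --> \oo] -->
      (push (isometric_continuous hoo) (mm_measure Xoo) : finmeas R Y).

(* Main.v *)
(** An isometric embedding f of complete spaces is closed and maps Borel sets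
    to Borel sets, so that pushing transport plans forward along f x f shows
    that ET does not increase under f.

    If D_ET tends to 0 along spaces Y_n realising the Sturm distance up to
    1/(n+1), first glue Y_n to X_n and to X_oo along the supports (along one
    point when a support is empty), which gives Z_n containing X_n and X_oo.
    The spaces Z_n are then glued together along X_oo. In the resulting space
    the images of mu_n converge to that of mu_oo for D_ET, hence weakly.
    Conversely, embeddings of X_n and X_oo in a common space restrict to the
    supports, which carry the whole measures, so the Sturm distance is at most
    the distance D_ET in that space. *)
Require Import Defs.
From HB Require Import structures.
From mathcomp Require Import all_boot all_order all_algebra.
From mathcomp Require Import all_classical all_reals all_analysis.
From mathcomp Require Import measurable_realfun lra.
Import numFieldTopology.Exports numFieldNormedType.Exports.
Local Open Scope classical_set_scope.

Set Implicit Arguments.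
Unset Strict Implicit.
Unset Printing Implicit Defensive.

Import Order.TTheory GRing.Theory Num.Theory.
Local Open Scope ring_scope.

(** * Completing and gluing metric spaces *)

Section inf_sum.
Context (R : realType) (I : Type).
Implicit Types f g : I -> R.

(** With [f i] and [g i] the distances from two points to the place [i], this is the length of a
    shortest route through such a place. It gives the distance in a completion and the distance
    across a gluing. *)
Definition inf_sum f g : R := inf (range (fun i => f i + g i)).

Lemma inf_sum_le f g i : (forall i, 0 <= f i) -> (forall i, 0 <= g i) ->
  inf_sum f g <= f i + g i.
Proof.
move=> f0 g0; apply: ge_inf; last by exists i.
by exists 0 => _ [j _ <-]; rewrite addr_ge0.
Qed.

Lemma le_inf_sum f g (i0 : I) c : (forall i, c <= f i + g i) ->
  c <= inf_sum f g.
Proof.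
move=> h; apply: lb_le_inf; first by exists (f i0 + g i0), i0.
by move=> _ [j _ <-]; exact: h.
Qed.

Lemma inf_sumC f g : inf_sum f g = inf_sum g f.
Proof. by rewrite /inf_sum; under eq_fun do rewrite addrC. Qed.

End inf_sum.

(** Points at distance 0 may differ: a gluing puts the points to be identified at distance 0, and
    passing to the completion merges them. *)
Record separable_pseudometric (R : realType) (T : Type) (d : T -> T -> R) :
    Prop := SeparablePseudometric {
  pseudometricxx : forall x, d x x = 0 ;
  pseudometric_sym : forall x y, d x y = d y x ;
  pseudometric_triangle : forall y x z, d x z <= d x y + d y z ;
  pseudometric_separable : exists2 S : set T, countable S &
    forall x e, 0 < e -> exists2 s, S s & d x s < e }.

(* The completion of the metric quotient of [(T, d)], realised as the uniform
   closure of the functions [d x]; the function [f] stands for the point at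
   distance [f y] from each [y]. *)
Definition completion (R : realType) (T : Type) (d : T -> T -> R)
    (hd : separable_pseudometric d) (t0 : T) : Type :=
  {f : T -> R | forall e, 0 < e -> exists x, forall y, `|f y - d x y| <= e}.

Section completion.
Context (R : realType) (T : Type) (d : T -> T -> R).
Context (hd : separable_pseudometric d) (t0 : T).
Local Notation Y := (completion hd t0).
Implicit Types f g h : Y.

HB.instance Definition _ := gen_eqMixin Y.
HB.instance Definition _ := gen_choiceMixin Y.

Let dist (f g : Y) := inf_sum (sval f) (sval g).

Lemma pseudometric_ge0 x y : 0 <= d x y.
Proof.
have := pseudometric_triangle hd y x x.
by rewrite (pseudometricxx hd) (pseudometric_sym hd y x) -mulr2n pmulrn_lge0.
Qed.

(** This bound and the next two hold for the functions [d x], where they are positivity and triangle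
    inequalities, and survive uniform approximation. *)
Lemma completion_ge0 (f : Y) y : 0 <= sval f y.
Proof.
apply/ler_addgt0Pr => e e0; have [x /(_ y)] := svalP f _ e0.
by have := pseudometric_ge0 x y; rewrite ler_norml; lra.
Qed.

Lemma completion_lipschitz (f : Y) y z : sval f z <= sval f y + d y z.
Proof.
apply/ler_addgt0Pr => e e0; have [|x hx] := svalP f (e / 2); first lra.
have := hx y; have := hx z; have := pseudometric_triangle hd y x z.
by rewrite !ler_norml; lra.
Qed.

Lemma completion_le_sum (f : Y) y z : d y z <= sval f y + sval f z.
Proof.
apply/ler_addgt0Pr => e e0; have [|x hx] := svalP f (e / 2); first lra.
have := hx y; have := hx z; have := pseudometric_triangle hd x y z.
by rewrite (pseudometric_sym hd y x) !ler_norml; lra.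
Qed.

Let dist_le f g y : dist f g <= sval f y + sval g y.
Proof. by apply: inf_sum_le => z; exact: completion_ge0. Qed.

(** With [f y] read as the distance from [f] to [y], this follows the route [f], [y], [g], [z].
    Separation and the triangle inequality of [dist] both rest on it. *)
Let le_add f g y z : sval f z <= sval f y + sval g y + sval g z.
Proof.
by have := completion_lipschitz f y z; have := completion_le_sum g y z; lra.
Qed.

Let le_dist f g t : sval f t <= dist f g + sval g t.
Proof.
rewrite -lerBlDr; apply: (le_inf_sum t0) => y.
by have := le_add f g y t; lra.
Qed.

Let distxx f : dist f f = 0.
Proof.
apply/eqP; rewrite eq_le; apply/andP; split; last first.
  by apply: (le_inf_sum t0) => y; rewrite addr_ge0 // completion_ge0.
apply/ler_addgt0Pr => e e0; have [|x /(_ x)] := svalP f (e / 2); first lra.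
have := dist_le f f x.
by rewrite (pseudometricxx hd) ler_norml; lra.
Qed.

Let distC f g : dist f g = dist g f. Proof. exact: inf_sumC. Qed.

Let dist_positivity f g : dist f g = 0 -> f = g.
Proof.
move=> fg; apply: eq_sig_hprop => [?|]; first exact: Prop_irrelevance.
apply/funext => y; apply/eqP; rewrite eq_le.
by have := le_dist f g y; have := le_dist g f y; rewrite distC fg !add0r => -> ->.
Qed.

Let dist_triangle g f h : dist f h <= dist f g + dist g h.
Proof.
rewrite -lerBlDr; apply: (le_inf_sum t0) => y.
rewrite lerBlDr addrC -lerBlDr; apply: (le_inf_sum t0) => z.
by have := dist_le f h z; have := le_add f g y z; lra.
Qed.

HB.instance Definition _ := isMetric.Build R Y
  distxx dist_positivity distC dist_triangle.

Lemma completion_subproof x e : 0 < e ->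
  exists z, forall y, `|d x y - d z y| <= e.
Proof. by move=> e0; exists x => y; rewrite subrr normr0 ltW. Qed.

Definition to_completion (x : T) : Y := exist _ (d x) (completion_subproof x).

Lemma mdist_to_completion_l x (f : Y) : mdist (to_completion x) f = sval f x.
Proof.
apply/eqP; rewrite eq_le; apply/andP; split.
  by rewrite (le_trans (dist_le _ _ x)) //= (pseudometricxx hd) add0r.
apply: (le_inf_sum t0) => y /=.
by have := completion_lipschitz f y x; rewrite (pseudometric_sym hd y); lra.
Qed.

Lemma mdist_to_completion x y :
  mdist (to_completion x) (to_completion y) = d x y.
Proof. by rewrite mdist_to_completion_l /= (pseudometric_sym hd). Qed.

Lemma to_completion_dense (f : Y) e : 0 < e ->
  exists x, mdist f (to_completion x) < e.
Proof.
move=> e0; have [|x /(_ x)] := svalP f (e / 2); first lra.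
rewrite (pseudometricxx hd) ler_norml => hx.
by exists x; rewrite metric_sym mdist_to_completion_l; lra.
Qed.

HB.instance Definition _ := isPointed.Build Y (to_completion t0).

Let completion_complete (G : set_system Y) :
  ProperFilter G -> cauchy G -> cvg G.
Proof.
move=> PG /cauchyP Gc.
(* The limit will send [t] to the infimum of [d x t + e] over the pairs [(x, e)], with [e] positive,
   for which the ball of radius [e] around [x] belongs to [G]. *)
pose near_pt (p : T * R) := 0 < p.2 /\ G (ball (to_completion p.1) p.2).
pose A t := [set d p.1 t + p.2 | p in near_pt].
have near_ex e : 0 < e -> exists x, near_pt (x, e).
  move=> e0; have [|f Gf] := Gc (e / 2); first lra.
  have [|x xf] := @to_completion_dense f (e / 2); first lra.
  exists x; split=> //=; apply: filterS Gf => g; rewrite !ballEmdist /= => fg.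
  have := metric_triangle (to_completion x) f g.
  by rewrite (metric_sym _ f); lra.
(* Two members of a proper filter meet, and a common point links the two centres. *)
have near_d p q : near_pt p -> near_pt q -> d p.1 q.1 <= p.2 + q.2.
  move=> [_ Gp] [_ Gq]; have [g [/=]] := filter_ex (filterI Gp Gq).
  rewrite !ballEmdist /= => pg qg.
  have := metric_triangle (to_completion p.1) g (to_completion q.1).
  by rewrite (metric_sym g) mdist_to_completion; lra.
have Alb t p : near_pt p -> lbound (A t) (d p.1 t - p.2).
  move=> np _ [q nq <-]; have := near_d _ _ np nq.
  by have := pseudometric_triangle hd q.1 p.1 t; lra.
(* The error [p.2] does not depend on [t], so the infimum is a uniform limit of functions [d x],
   that is, a point of the completion. *)
have infA t p : near_pt p -> `|inf (A t) - d p.1 t| <= p.2.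
  move=> np; rewrite ler_norml lerBrDr lerBlDr; apply/andP; split.
    rewrite addrC; apply: lb_le_inf; last exact: Alb.
    by exists (d p.1 t + p.2), p.
  rewrite addrC; apply: ge_inf; last by exists p.
  by exists (d p.1 t - p.2); exact: Alb.
have gP e : 0 < e -> exists x, forall y, `|inf (A y) - d x y| <= e.
  move=> e0; have [x nx] := near_ex _ e0.
  by exists x => y; exact: infA _ _ nx.
pose g : Y := exist _ (fun t => inf (A t)) gP.
apply/cvg_ex; exists g.
apply/metricType_numDomainType.fcvgrPdist_lt => e e0.
have [|x nx] := near_ex (e / 3); first lra.
case: (nx) => _ /=; apply: filterS => h; rewrite ballEmdist /= => xh.
have gx : mdist g (to_completion x) <= e / 3.
  have := infA x _ nx; rewrite metric_sym mdist_to_completion_l.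
  by rewrite /= (pseudometricxx hd) ler_norml; lra.
have := metric_triangle g (to_completion x) h.
lra.
Qed.

HB.instance Definition _ := Uniform_isComplete.Build Y completion_complete.

Let completion_separable : exists2 S : set Y, countable S & dense S.
Proof.
have [S cS dS] := pseudometric_separable hd.
exists (to_completion @` S); first exact: sub_countable (card_image_le _ _) cS.
move=> O [f Of]; rewrite openE => /(_ _ Of)/metricType_numDomainType.nbhs_mdistP.
move=> [e /= e0 sO]; have [|x fx] := @to_completion_dense f (e / 2); first lra.
have [|s Ss xs] := dS x (e / 2); first lra.
exists (to_completion s); split; last by exists s.
apply: sO => /=; have := metric_triangle f (to_completion x) (to_completion s).
by rewrite mdist_to_completion; lra.
Qed.

HB.instance Definition _ := isSeparable.Build Y completion_separable.

End completion.

Lemma pseudometric_to_polish (R : realType) (T : Type) (d : T -> T -> R)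
    (t0 : T) : separable_pseudometric d ->
  exists (Y : polishMetricType R) (j : T -> Y),
    forall x y, mdist (j x) (j y) = d x y.
Proof.
move=> hd; exists (completion hd t0), (to_completion hd t0).
exact: mdist_to_completion.
Qed.

Lemma polish_separable (R : realType) (X : polishMetricType R) :
  exists2 S : set X, countable S &
    forall x e, 0 < e -> exists2 s, S s & mdist x s < e.
Proof.
have [S cS dS] := @separable R X; exists S => // x e e0.
have [||y [xy Sy]] := dS (ball x e)^°.
- by exists x; apply: nbhsx_ballx.
- exact: open_interior.
by exists y => //; move/interior_subset : xy; rewrite ballEmdist.
Qed.

Section glue.
Context (R : realType) (K : countType) (Z : K -> polishMetricType R) (k0 : K).
Context (I : Type) (i0 : I) (e : forall k, I -> Z k).
Hypothesis eP : forall k m i j, mdist (e k i) (e k j) = mdist (e m i) (e m j).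

Let T := {k & Z k}.
Let phi (p : T) (i : I) : R := mdist (tagged p) (e (tag p) i).
(** Points of one piece keep their distance; points of distinct pieces are joined by a shortest
    route through the copies of [I]. The copies of the same [i] thus lie at distance 0. *)
Let d (p q : T) : R := if tag p == tag q then mdist (tagged p) (tagged_as p q)
  else inf_sum (phi p) (phi q).

Let phi_ge0 p i : 0 <= phi p i. Proof. exact: mdist_ge0. Qed.

Let dEsame k (x y : Z k) : d (Tagged Z x) (Tagged Z y) = mdist x y.
Proof. by rewrite /d /= eqxx tagged_asE. Qed.

Let dEdiff p q : tag p != tag q -> d p q = inf_sum (phi p) (phi q).
Proof. by rewrite /d => /negPf ->. Qed.

(** By [eP] distances between points of [I] can be read in any piece; [k0] is a fixed reference, so
    that estimates from different pieces can be combined. *)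
Let phi_lip p i j : phi p j <= phi p i + mdist (e k0 i) (e k0 j).
Proof. by rewrite (eP k0 (tag p)); exact: metric_triangle. Qed.

Let phi_sum p i j : mdist (e k0 i) (e k0 j) <= phi p i + phi p j.
Proof.
rewrite (eP k0 (tag p)) (le_trans (metric_triangle _ (tagged p) _)) //.
by rewrite lerD2r metric_sym.
Qed.

Let dC p q : d p q = d q p.
Proof.
case: (eqVneq (tag p) (tag q)) => [|pq].
  case: p q => [k x] [m y] /= km; rewrite {}km in x *.
  by rewrite !dEsame metric_sym.
by rewrite (dEdiff pq) inf_sumC dEdiff // eq_sym.
Qed.

Let d_phi p q i : d p q <= phi p i + phi q i.
Proof.
case: (eqVneq (tag p) (tag q)) => [|pq]; last first.
  by rewrite dEdiff //; exact: inf_sum_le.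
case: p q => [k x] [m y] /= km; rewrite {}km in x *; rewrite dEsame.
by rewrite (le_trans (metric_triangle _ (e m i) _)) // lerD2l metric_sym.
Qed.

Let phi_d p q i : tag p = tag q -> phi p i <= d p q + phi q i.
Proof.
case: p q => [k x] [m y] /= km; rewrite {}km in x *; rewrite dEsame.
exact: metric_triangle.
Qed.

Let d_triangle q p r : d p r <= d p q + d q r.
Proof.
case: (eqVneq (tag p) (tag q)) => [pq|pq].
  case: (eqVneq (tag q) (tag r)) => [|qr].
    case: p q r pq => [k x] [m y] [n z] /= km mn.
    by rewrite {}km {}mn in x y *; rewrite !dEsame metric_triangle.
  rewrite (dEdiff qr) -lerBlDl; apply: (le_inf_sum i0) => i.
  by have := d_phi p r i; have := phi_d i pq; lra.
rewrite (dEdiff pq) -lerBlDr; apply: (le_inf_sum i0) => i.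
case: (eqVneq (tag q) (tag r)) => [qr|qr].
  have := d_phi p r i; have := phi_d i (esym qr); rewrite (dC r); lra.
(* The route runs through [p], [i], [q], [j], [r]. The detour by [q] dominates the distance from [i]
   to [j], and [d_phi] also covers [p] and [r] lying in the same piece. *)
rewrite lerBlDr -lerBlDl (dEdiff qr); apply: (le_inf_sum i0) => j.
have := d_phi p r j; have := phi_lip p i j; have := phi_sum q i j; lra.
Qed.

Let d_separable : exists2 S : set T, countable S &
  forall x eps, 0 < eps -> exists2 s, S s & d x s < eps.
Proof.
pose S k := s2val (cid2 (polish_separable (Z k))).
exists (\bigcup_(k in setT) (Tagged Z @` S k)).
  apply: bigcup_countable; first exact: countableP.
  move=> k _; apply: sub_countable (card_image_le _ _) _.
  exact: s2valP (cid2 (polish_separable (Z k))).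
move=> [k x] eps eps0.
have [s Ss xs] := s2valP' (cid2 (polish_separable (Z k))) x _ eps0.
by exists (Tagged Z s); [exists k => //; exists s|rewrite dEsame].
Qed.

Lemma glue : exists (Y : polishMetricType R) (j : forall k, Z k -> Y),
  (forall k, isometric_embedding (j k)) /\
  (forall k m i, j k (e k i) = j m (e m i)).
Proof.
have hd : separable_pseudometric d.
  split=> //; by [case=> k x; rewrite dEsame mdistxx|].
have [Y [j jd]] := pseudometric_to_polish (Tagged Z (e k0 i0)) hd.
exists Y, (fun k x => j (Tagged Z x)); split=> [k x y|k m i].
  by rewrite jd dEsame.
apply: mdist_positivity; apply/eqP; rewrite eq_le mdist_ge0 andbT jd.
by rewrite (le_trans (d_phi _ _ i)) // /phi /= !mdistxx addr0.
Qed.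

End glue.

Lemma glue2 (R : realType) (A B : polishMetricType R) (S : set A) (psi : S -> B) :
  isometric_embedding psi ->
  exists (Y : polishMetricType R) (jA : A -> Y) (jB : B -> Y),
    [/\ isometric_embedding jA, isometric_embedding jB &
        forall s : S, jA (set_val s) = jB (psi s)].
Proof.
move=> hpsi.
pose Z (b : bool) : polishMetricType R := if b then A else B.
(* [glue] asks for an inhabited index. If [S] is empty, the two base points are identified instead;
   otherwise [S] itself is the index. *)
have [S0|/set0P[s0 Ss0]] := eqVneq S set0.
  have [|Y [j [hj _]]] := @glue R bool Z true unit tt
    (fun b => if b as b return unit -> Z b then fun _ => point else fun _ => point).
    by case=> -[] _ _; rewrite !mdistxx.
  exists Y, (j true), (j false); split; [exact: (hj true)|exact: (hj false)|].
  by move=> s; exfalso; move: (set_valP s); rewrite [X in X _]S0.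
have [|Y [j [hj ej]]] := @glue R bool Z true S (exist _ s0 (mem_set Ss0))
    (fun b => if b as b return S -> Z b then set_val else psi).
  by case=> -[] x y //=; rewrite hpsi.
exists Y, (j true), (j false); split; [exact: (hj true)|exact: (hj false)|].
by move=> s; exact: (ej true false).
Qed.

(** * Isometric embeddings and Borel sets *)

Section isometric_image.
Context (R : realType) (X Y : polishMetricType R) (f : X -> Y).
Hypothesis hf : isometric_embedding f.

Lemma isometric_embedding_inj : injective f.
Proof.
by move=> x y fxy; apply: mdist_positivity; rewrite -hf fxy mdistxx.
Qed.

Lemma isometric_range_closed : closed (range f).
Proof.
move=> y cly.
(* [G] is generated by the preimages of the balls around [y]. It is Cauchy because [f] preserves
   distances, and its limit is mapped to [y]. *)
pose G : set_system X := filter_from [set e : R | 0 < e]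
  (fun e => [set x | mdist (f x) y < e]).
have Gex e : 0 < e -> exists x, mdist (f x) y < e.
  move=> e0; have [|_ [[x _ <-]]] := cly (ball y e); first exact: nbhsx_ballx.
  by rewrite ballEmdist /= metric_sym; exists x.
have PG : ProperFilter G.
  apply: filter_from_proper; last by move=> e /= /Gex[x]; exists x.
  apply: filter_from_filter; first by exists 1; rewrite /= ltr01.
  move=> e1 e2 /= e10 e20; exists (Num.min e1 e2); rewrite /= ?lt_min ?e10 //.
  by move=> x; rewrite /= lt_min => /andP.
have /cauchy_cvg/cvg_ex[x Gx] : cauchy G.
  apply/cauchyP => e e0; have [|x xy] := Gex (e / 2); first lra.
  exists x, (e / 2) => /=; first lra.
  move=> z /= zy; rewrite ballEmdist /= -hf.
  have := metric_triangle (f x) y (f z); rewrite (metric_sym y); lra.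
exists x => //; apply: mdist_positivity; apply/eqP; rewrite eq_le mdist_ge0 andbT.
apply/ler_addgt0Pr => e e0; rewrite add0r.
have Ge : G [set z | mdist (f z) y < e / 2] by exists (e / 2) => //=; lra.
have : G (ball x (e / 2)) by apply: Gx; apply: nbhsx_ballx; lra.
move=> /(filterI Ge)/filter_ex[z [/= zy]].
rewrite ballEmdist /= -hf => xz.
have := metric_triangle (f x) (f z) y; lra.
Qed.

(** The sets with Borel image form a sigma-algebra: by injectivity the image of a complement is the
    complement of the image within the closed range. There remain the open sets. *)
Lemma isometric_image_measurable (A : set (borel X)) :
  measurable A -> measurable (f @` A : set (borel Y)).
Proof.
have mC : measurable (range f : set (borel Y)).
  rewrite -[range f]setCK; apply: measurableC; apply: sub_sigma_algebra.
  by rewrite openC; exact: isometric_range_closed.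
move: A; apply: (@smallest_sub _ _ _
  [set A | measurable (f @` A : set (borel Y))]).
  split => /=.
  - by rewrite image_set0; exact: measurable0.
  - move=> A mA; rewrite setTD.
    suff -> : f @` (~` A) = range f `\` f @` A by exact: measurableD.
    apply/seteqP; split=> [_ [x nAx <-]|_ [[x _ <-] nA]].
      split; first by exists x.
      by move=> [z Az /isometric_embedding_inj zx]; apply: nAx; rewrite -zx.
    by exists x => // Ax; apply: nA; exists x.
  - by move=> F mF; rewrite image_bigcup; exact: bigcupT_measurable.
move=> U oU /=.
(* The image of [U] is relatively open in the range: near one of its points, every point of the
   range comes from [U]. *)
suff -> : f @` U = range f `&` (f @` U `|` ~` range f)^°.
  apply: measurableI => //; apply: sub_sigma_algebra; exact: open_interior.
apply/seteqP; split=> [_ [x Ux <-]|y [[x _ <-] /interior_subset[//|]]]; last first.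
  by move=> /(_ (ex_intro2 _ _ x I erefl)).
split; first by exists x.
move: oU; rewrite openE => /(_ _ Ux)/nbhs_ballP[e /= e0 xeU].
apply/nbhs_ballP; exists e => // y; rewrite ballEmdist /= => xy.
have [[z _ zy]|?] := pselect (range f y); [left|by right].
by exists z => //; apply: xeU; rewrite ballEmdist /= -hf zy.
Qed.

End isometric_image.

(** * Measurability of distances and of convex functions *)

Lemma continuous_borel_measurable (R : realType) (X : ptopologicalType)
    (h : X -> R) :
  continuous h -> measurable_fun [set: borel X] (h : borel X -> R).
Proof.
move=> /continuousP ch; apply: (measurability _ (RGenOpens.measurableE R)).
move=> _ [_ [a [b ->] <-]]; rewrite setTI; apply: sub_sigma_algebra.
by apply: ch; exact: interval_open.
Qed.

Lemma mdist_continuous (R : realType) (X : metricType R) :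
  continuous (fun p : X * X => mdist p.1 p.2).
Proof.
move=> [x y]; apply/cvgrPdist_lt => e e0 /=.
have e20 : 0 < e / 2 by lra.
have nx := @metricType_numDomainType.cvgr_dist_lt _ _ _ _ _ fst x cvg_fst _ e20.
have ny := @metricType_numDomainType.cvgr_dist_lt _ _ _ _ _ snd y cvg_snd _ e20.
near=> p.
have xp : mdist x p.1 < e / 2 by near: p; exact: nx.
have yp : mdist y p.2 < e / 2 by near: p; exact: ny.
rewrite ltr_norml.
have := metric_triangle x p.1 y; have := metric_triangle p.1 p.2 y.
have := metric_triangle p.1 x p.2; have := metric_triangle x y p.2.
by rewrite (metric_sym p.1 x) (metric_sym p.2 y); lra.
Unshelve. all: by end_near. Qed.

Section convex_measurability.
Local Open Scope ereal_scope.
Context (R : realType) d (T : measurableType d) (G : R -> \bar R) (h : T -> R).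

(** The sublevel sets of a convex function on the half-line are intervals, hence Borel. *)
Lemma convex_measurable_comp : convex_nonneg G -> measurable_fun [set: T] h ->
  (forall x, (0 <= h x)%R) -> measurable_fun [set: T] (fun x => G (h x)).
Proof.
move=> cG mh h0; apply: (measurability _ (ErealGenOInfty.measurableE R)).
move=> /= _ [_ [a ->]] <-; rewrite setTI.
rewrite [X in measurable X](_ : _ =
  ~` (h @^-1` [set s | (0 <= s)%R /\ G s <= a%:E])); last first.
  apply/seteqP; split => x /=; rewrite in_itv /= andbT.
    by move=> aG [_]; rewrite leNgt aG.
  by move=> nG; rewrite ltNge; apply/negP => Ga; apply: nG.
apply: measurableC; rewrite -[X in measurable X]setTI; apply: mh => //.
apply: is_interval_measurable => s t /= [s0 Gs] [t0 Gt] u /andP[su ut].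
have [st|st] := eqVneq s t.
  by have -> : u = s by apply/eqP; rewrite eq_le su st ut.
split; first exact: le_trans su.
have ts : (0 < t - s)%R by rewrite subr_gt0 lt_neqAle st (le_trans su).
(* The weight that writes [u] as a convex combination of [s] and [t]. *)
pose v := ((u - s) / (t - s))%R.
have v01 : (0 <= v <= 1)%R.
  rewrite divr_ge0 ?subr_ge0 ?(le_trans su) //=.
  by rewrite ler_pdivrMr // mul1r lerD2r.
have -> : u = ((1 - v) * s + v * t)%R.
  have : (v * (t - s) = u - s)%R by rewrite /v divfK // gt_eqF.
  by lra.
have /andP[v0 v1] := v01.
rewrite (le_trans (cG _ _ _ s0 t0 v01)) //.
rewrite (_ : a%:E = (1 - v)%:E * a%:E + v%:E * a%:E); last first.
  by rewrite -!EFinM -EFinD; congr (_%:E); lra.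
by apply: leeD; apply: lee_wpmul2l => //; rewrite lee_fin subr_ge0.
Qed.

End convex_measurability.

(** * Divergences and Entropy-Transport costs *)

Section divergence.
Local Open Scope ereal_scope.
Context (R : realType).

Section lebesgue_decomposition.
Context (X : ptopologicalType) (gamma mu : finmeas R X).
Local Notation mu' := (mu : {measure set (borel X) -> \bar R}).

(** The density part does not charge [N] and the singular part lives on [N], so both can be read off
    [gamma] once [N] is known. *)
Lemma lebesgue_decomposition_off_null sigma gammaS (N : set (borel X)) :
  lebesgue_decomposition gamma mu sigma gammaS ->
  measurable N -> mu N = 0 -> gammaS (~` N) = 0 ->
  (forall A : set (borel X), measurable A ->
    \int[mu']_(x in A) (sigma x)%:E = gamma (A `\` N)) /\
  gammaS [set: X] = gamma N.
Proof.
move=> [ms s0 _ E] mN muN gN.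
have mis A : measurable_fun (A : set (borel X)) (EFin \o sigma).
  by apply/measurable_EFinP; exact: measurable_funS ms.
have intA (A : set (borel X)) : measurable A ->
    \int[mu']_(x in A) (sigma x)%:E = gamma (A `\` N).
  move=> mA; rewrite (@ge0_negligible_integral _ _ _ _ _ N) //; last first.
    by move=> x _; rewrite lee_fin.
  rewrite E; last exact: measurableD.
  rewrite [X in _ = _ + X](@subset_measure0 _ _ _ _ _ (~` N)) ?adde0 //.
  - exact: measurableD.
  - exact: measurableC.
split=> //; rewrite E // intA // setDv measure0 add0e.
rewrite -[in LHS](setvU N) setUC measureU0 //; exact: measurableC.
Qed.

Lemma lebesgue_decomposition_unique sigma1 gamma1 sigma2 gamma2 :
  lebesgue_decomposition gamma mu sigma1 gamma1 ->
  lebesgue_decomposition gamma mu sigma2 gamma2 ->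
  ae_eq mu' setT (EFin \o sigma1) (EFin \o sigma2)
    /\ gamma1 [set: X] = gamma2 [set: X].
Proof.
move=> LD1 LD2.
have [ms1 s10 [N1 mN1 [muN1 gN1]] _] := LD1.
have [ms2 s20 [N2 mN2 [muN2 gN2]] _] := LD2.
(* The union serves both decompositions at once, so each of them is expressed by [gamma] and the
   same [N]. *)
pose N := N1 `|` N2.
have mN : measurable (N : set (borel X)) by exact: measurableU.
have muN : mu N = 0 by rewrite /N measureU0.
have [i1 g1] : (forall A : set (borel X), measurable A ->
    \int[mu']_(x in A) (sigma1 x)%:E = gamma (A `\` N)) /\
    gamma1 [set: X] = gamma N.
  apply: lebesgue_decomposition_off_null => //.
  apply: (@subset_measure0 _ _ _ _ _ (~` N1)) => //; try exact: measurableC.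
  by apply: subsetC; exact: subsetUl.
have [i2 g2] : (forall A : set (borel X), measurable A ->
    \int[mu']_(x in A) (sigma2 x)%:E = gamma (A `\` N)) /\
    gamma2 [set: X] = gamma N.
  apply: lebesgue_decomposition_off_null => //.
  apply: (@subset_measure0 _ _ _ _ _ (~` N2)) => //; try exact: measurableC.
  by apply: subsetC; exact: subsetUr.
split; last by rewrite g1 g2.
apply: integral_ae_eq => //.
- apply/integrableP; split; first exact/measurable_EFinP.
  under eq_integral do rewrite /= ger0_norm //.
  rewrite i1 // ltey_eq fin_num_measure //; exact: measurableD.
- exact/measurable_EFinP.
- by move=> A _ mA /=; rewrite i1 // i2.
Qed.

(** The value picked by [xget] comes from some decomposition, and uniqueness compares that one with
    the given one. *)
Lemma divergenceE F sigma gammaS : entropy_function F ->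
  lebesgue_decomposition gamma mu sigma gammaS ->
  divergence F gamma mu =
    \int[mu']_x F (sigma x) + recession F * gammaS [set: X].
Proof.
move=> hF LD; rewrite /divergence; set S := [set v | _].
have [s [g [LD' ->]]] : S (xget +oo S).
  apply: (@xgetI _ +oo S (\int[mu']_x F (sigma x) + recession F * gammaS [set: X])).
  by exists sigma, gammaS.
have [sE ->] := lebesgue_decomposition_unique LD' LD.
congr (_ + _); apply: ge0_ae_eq_integral => //.
- by case: LD' => ms s0 _ _; apply: convex_measurable_comp => //; exact: entropy_convex.
- by case: LD => ms s0 _ _; apply: convex_measurable_comp => //; exact: entropy_convex.
- by case: LD' => ms s0 _ _ x _; apply: entropy_ge0.
- by case: LD => ms s0 _ _ x _; apply: entropy_ge0.
by apply: filterS sE => x /= + _ => /(_ I)[->].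
Qed.

Lemma divergence_ge0 F : entropy_function F -> superlinear F ->
  0 <= divergence F gamma mu.
Proof.
move=> hF sF; rewrite /divergence; case: xgetP => //= _ _ [s [g [[ms s0 _ _] ->]]].
apply: adde_ge0; first by apply: integral_ge0 => x _; exact: entropy_ge0.
by rewrite sF mule_ge0 // measure_ge0.
Qed.

End lebesgue_decomposition.

Section divergence_isometry.
Context (X Y : polishMetricType R) (f : X -> Y) (hf : isometric_embedding f).
Let cf := isometric_continuous hf.
Context (gamma mu : finmeas R X) (gamma' mu' : finmeas R Y).
Hypothesis gammaE : forall B : set (borel Y), measurable B ->
  gamma' B = gamma (f @^-1` B).
Hypothesis muE : forall B : set (borel Y), measurable B ->
  mu' B = mu (f @^-1` B).
Local Notation nu := (mu : {measure set (borel X) -> \bar R}).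
Local Notation nu' := (mu' : {measure set (borel Y) -> \bar R}).

Let mf : measurable_fun setT (f : borel X -> borel Y).
Proof. exact: borel_measurable_continuous. Qed.

Let integral_push (D : set (borel Y)) (h : Y -> \bar R) :
  measurable D -> measurable_fun D (h : borel Y -> _) ->
  {in D, forall y, 0 <= h y} ->
  \int[nu']_(y in D) h y = \int[nu]_(x in f @^-1` D) h (f x).
Proof.
move=> mD mh h0.
rewrite -[RHS]/(\int[nu]_(x in f @^-1` D) (h \o f) x).
rewrite -(@ge0_integral_pushforward _ _ (borel X) (borel Y) R f mf nu) //.
by apply: eq_measure_integral => A mA _; exact: muE.
Qed.

(* The density of the image measure is [sigma \o f^-1] on the closed set
   [range f]; its value outside is irrelevant. *)
Let extend (sigma : X -> R) (y : Y) : R :=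
  if pselect (exists x, f x = y) is left h then sigma (projT1 (cid h)) else 0.

Let extendE sigma x : extend sigma (f x) = sigma x.
Proof.
rewrite /extend; case: pselect => [h|[]]; last by exists x.
by case: cid => z /= /(isometric_embedding_inj hf) ->.
Qed.

Let extend_ge0 sigma : (forall x, (0 <= sigma x)%R) ->
  forall y, (0 <= extend sigma y)%R.
Proof. by move=> s0 y; rewrite /extend; case: pselect. Qed.

Let mrange : measurable (range f : set (borel Y)).
Proof. exact: (isometric_image_measurable hf). Qed.

Let measurable_extend (sigma : X -> R) :
  measurable_fun [set: borel X] (sigma : borel X -> R) ->
  measurable_fun [set: borel Y] (extend sigma : borel Y -> R).
Proof.
move=> ms _ B mB; rewrite setTI.
have mfB : measurable (f @` (sigma @^-1` B) : set (borel Y)).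
  apply: (isometric_image_measurable hf).
  by rewrite -[X in measurable X]setTI; exact: ms.
have extN y : ~ range f y -> extend sigma y = 0%R.
  by move=> ny; rewrite /extend; case: pselect => // -[x xy]; case: ny; exists x.
have fBE : range f `&` extend sigma @^-1` B = f @` (sigma @^-1` B).
  apply/seteqP; split=> [_ [[x _ <-]]|_ [x Bx <-]].
    by rewrite /= extendE; exists x.
  by split; [exists x|rewrite /= extendE].
rewrite -[X in measurable X]setTI -(setUv (range f)) setIUl fBE.
apply: measurableU => //; have [B0|B0] := pselect (B 0%R).
  rewrite [X in measurable X](_ : _ = ~` range f); first exact: measurableC.
  by apply: setIidl => y /extN /= ->.
rewrite [X in measurable X](_ : _ = set0); first exact: measurable0.
by rewrite -subset0 => y [/extN + /=] => ->.
Qed.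

Lemma divergence_isometry F : entropy_function F ->
  divergence F gamma' mu' <= divergence F gamma mu.
Proof.
(* If the set defining the right-hand side is empty, its default [+oo] settles the inequality;
   otherwise a decomposition on [X] is available for transport to [Y]. *)
move=> hF; rewrite [leRHS]/divergence; case: xgetP => [v vE|_]; last by rewrite leey.
case=> sigma [gammaS [[ms s0 [N mN [muN gN]] E] {vE}->]].
have mN' := isometric_image_measurable hf mN.
have fK : f @^-1` (f @` N) = N.
  by apply/seteqP; split=> [x [z Nz /(isometric_embedding_inj hf) <-]|x Nx] //; exists x.
have fKC : f @^-1` (~` (f @` N)) = ~` N := congr1 setC fK.
have mext := measurable_extend ms.
(* The image of [N] separates the two parts on [Y]: by injectivity its preimage is [N], so it is
   null for [mu'] and its complement is null for the pushed singular part. *)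
rewrite (@divergenceE _ _ _ _ (extend sigma) (push cf gammaS)) //; last first.
  split=> //; first exact: extend_ge0.
    exists (f @` N) => //; rewrite muE // fK; split=> //.
    by rewrite -gN -fKC.
  move=> A mA; rewrite gammaE // E; last first.
    by rewrite -[X in measurable X]setTI; exact: mf.
  congr (_ + _); rewrite integral_push //.
  - by apply: eq_integral => x _; rewrite extendE.
  - by apply/measurable_EFinP; exact: measurable_funS mext.
  - by move=> y _; rewrite lee_fin extend_ge0.
rewrite le_eqVlt; apply/orP; left; apply/eqP; congr (_ + _).
rewrite integral_push //.
- by apply: eq_integral => x _; rewrite extendE.
- by apply: convex_measurable_comp => //; [exact: entropy_convex|exact: extend_ge0].
- by move=> y _; apply: entropy_ge0 => //; exact: extend_ge0.
Qed.

End divergence_isometry.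
End divergence.

(** The image measures are described by their values on Borel sets, so that the inequality applies
    to [push] and to [push_supp] alike. *)
Lemma ET_isometry (R : realType) (F l : R -> \bar R) (X Y : polishMetricType R)
    (f : X -> Y) (mu1 mu2 : finmeas R X) (nu1 nu2 : finmeas R Y) :
  entropy_function F -> superlinear F ->
  (forall s, 0 <= s -> (0 <= l s)%E) -> convex_nonneg l ->
  isometric_embedding f ->
  (forall B : set (borel Y), measurable B -> nu1 B = mu1 (f @^-1` B)) ->
  (forall B : set (borel Y), measurable B -> nu2 B = mu2 (f @^-1` B)) ->
  (ET F (fun p : Y * Y => l (mdist p.1 p.2)) nu1 nu2 <=
   ET F (fun p : X * X => l (mdist p.1 p.2)) mu1 mu2)%E.
Proof.
move=> hF sF l0 cl hf E1 E2; apply: le_ereal_inf_tmp => _ [gamma _ <-]; cbv beta.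
pose ff (p : X * X) : Y * Y := (f p.1, f p.2).
have cff : continuous ff.
  move=> p; apply: cvg_pair.
    apply: (@continuous_comp _ _ _ fst f); first exact: cvg_fst.
    exact: isometric_continuous.
  apply: (@continuous_comp _ _ _ snd f); first exact: cvg_snd.
  exact: isometric_continuous.
apply: (@le_trans _ _ (divergence F (marginal1 (push cff gamma)) nu1 +
  divergence F (marginal2 (push cff gamma)) nu2 +
  \int[push cff gamma]_p l (mdist p.1 p.2))%E).
  by apply: ereal_inf_lbound; exists (push cff gamma).
have mc : measurable_fun [set: borel (Y * Y)%type] (fun p => l (mdist p.1 p.2)).
  apply: (@convex_measurable_comp _ _ _ l
    (fun p : borel (Y * Y)%type => mdist p.1 p.2)) => //.
    by apply: continuous_borel_measurable; exact: mdist_continuous.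
  by move=> p; exact: mdist_ge0.
apply: leeD; first by apply: leeD; apply: (divergence_isometry hf).
rewrite le_eqVlt; apply/orP; left; apply/eqP.
rewrite -[LHS]/(\int[pushforward (gamma : {measure set (borel (X * X)%type) -> \bar R})
  (ff : borel (X * X)%type -> borel (Y * Y)%type)]_(p in setT) l (mdist p.1 p.2))%E.
rewrite ge0_integral_pushforward //.
- by apply: eq_integral => p _ /=; rewrite hf.
- exact: borel_measurable_continuous.
- by move=> p _; apply: l0; exact: mdist_ge0.
Qed.

(** * Measures and their supports *)

(** By separability, countably many null balls cover the complement of the support. *)
Lemma measure_setC_supp (R : realType) (X : polishMetricType R)
    (mu : finmeas R X) : mu (~` supp mu) = 0%E.
Proof.
have [S /pcard_geP/unsquash s dS] := polish_separable X.
pose B k n : set X := (ball (s k) n.+1%:R^-1)^°.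
pose E k n : set (borel X) := [set x | mu (B k n) = 0%E /\ B k n x].
have mB k n : measurable (B k n : set (borel X)).
  by apply: sub_sigma_algebra; exact: open_interior.
have E0 k n : (mu : {measure set (borel X) -> \bar R}).-negligible (E k n).
  have [muB|muB] := pselect (mu (B k n) = 0%E).
    by exists (B k n); split=> // x [].
  by exists set0; split=> // x [].
have : (mu : {measure set (borel X) -> \bar R}).-negligible
    (\bigcup_k \bigcup_n E k n).
  by apply: negligible_bigcup => k; exact: negligible_bigcup.
move=> [N [mN N0 EN]]; apply: (@subset_measure0 _ _ _ _ _ N) => //.
  by apply: sub_sigma_algebra; rewrite openC; exact: closed_supp.
apply: subset_trans EN => x /existsNP[U /not_implyP[[oU Ux] /negP]].
rewrite -leNgt => muU; move: (oU); rewrite openE => /(_ _ Ux)/nbhs_ballP[e /= e0 xeU].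
have e20 : 0 < e / 2 by lra.
(* The radius [1/(n+1)] is below [e/2] and the centre is closer to [x] than this radius: the ball
   contains [x] and stays inside [U], hence is null. *)
have [n _ /(_ n (leqnn n)) /= en] := near_infty_natSinv_lt (PosNum e20).
have [y Sy xy] := dS x n.+1%:R^-1 ltac:(by rewrite invr_gt0 ltr0n).
have [k _ sk] := 'surj_s Sy.
exists k => //; exists n => //; split.
  apply/eqP; rewrite eq_le measure_ge0 andbT (le_trans _ muU) //.
  apply: le_measure; rewrite ?inE; [exact: mB|exact: sub_sigma_algebra|].
  apply: subset_trans xeU => z /interior_subset; rewrite sk !ballEmdist /= => yz.
  by have := metric_triangle x y z; move: xy yz en; move: (n.+1%:R^-1) => r; lra.
apply/nbhs_ballP; exists (n.+1%:R^-1 - mdist x y); rewrite /= ?subr_gt0 // => z.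
rewrite sk !ballEmdist /= => xz.
have := metric_triangle y x z; move: xz; rewrite (metric_sym y x).
by move: (n.+1%:R^-1) => r; lra.
Qed.

(** The two sets differ only within the null complement of the support. This identifies [push_supp]
    of a restricted map with [push] of the whole map. *)
Lemma measure_image_supp (R : realType) (X Y : polishMetricType R)
    (mu : finmeas R X) (i : X -> Y) (psi : supp mu -> Y) :
  continuous i -> (forall s, psi s = i (set_val s)) ->
  forall B : set (borel Y), measurable B ->
    mu (set_val @` (psi @^-1` B)) = mu (i @^-1` B).
Proof.
move=> ci psiE B mB.
have mS : measurable (~` supp mu : set (borel X)).
  by apply: sub_sigma_algebra; rewrite openC; exact: closed_supp.
have mi : measurable (i @^-1` B : set (borel X)).
  rewrite -[X in measurable X]setTI.
  exact: (borel_measurable_continuous ci).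
have -> : set_val @` (psi @^-1` B) = (i @^-1` B) `\` (~` supp mu) :> set X.
  apply/seteqP; split=> [_ [s Bs <-]|x [Bx /contrapT sx]].
    split; first by rewrite /= -psiE.
    by move=> /=; apply; exact: set_valP.
  by exists (exist _ x (mem_set sx)) => //; rewrite /= psiE.
apply/eqP; rewrite eq_le; apply/andP; split.
  by apply: le_measure; rewrite ?inE //; exact: measurableD.
rewrite [leLHS](@measureDI _ _ _ mu (i @^-1` B) (~` supp mu)) //.
rewrite [X in (_ + X <= _)%E](_ : _ = 0%E) ?adde0 //.
apply: (@subset_measure0 _ _ _ mu (i @^-1` B `&` ~` supp mu) (~` supp mu)) => //.
  exact: measurableI.
exact: measure_setC_supp.
Qed.

(** * The Sturm distance and distances in common spaces *)

Lemma ereal_cvg0P (R : realType) (u : nat -> \bar R) : (forall n, 0 <= u n)%E ->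
  u n @[n --> \oo] --> 0%E <->
  forall e : R, 0 < e -> \forall n \near \oo, (u n < e%:E)%E.
Proof.
move=> u0; split=> [u_0 e e0|u_e].
  by apply: (u_0 (fun y => y < e%:E)%E); apply: open_ereal_lt'; rewrite lte_fin.
apply/fine_cvgP; split.
  apply: filterS (u_e 1 ltr01) => n un1.
  by rewrite ge0_fin_numE // (lt_trans un1) // ltry.
apply/cvgrPdist_lt => e e0; apply: filterS (u_e _ e0) => n une.
rewrite sub0r normrN /= ger0_norm ?fine_ge0 // -lte_fin fineK //.
by rewrite ge0_fin_numE // (lt_trans une) // ltry.
Qed.

Section regular.
Context (R : realType) (a : R) (F l : R -> \bar R) (hreg : regular_ET a F l).

Lemma DET_isometry (X Y : polishMetricType R) (f : X -> Y)
    (mu1 mu2 : finmeas R X) (nu1 nu2 : finmeas R Y) :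
  isometric_embedding f ->
  (forall B : set (borel Y), measurable B -> nu1 B = mu1 (f @^-1` B)) ->
  (forall B : set (borel Y), measurable B -> nu2 B = mu2 (f @^-1` B)) ->
  (DET a F l nu1 nu2 <= DET a F l mu1 mu2)%E.
Proof.
case: hreg => /andP[a0 _] hF sF _ l0 _ cl _ _ hf E1 E2.
have ET_ge0 (Z : polishMetricType R) (m1 m2 : finmeas R Z) :
    (0 <= ET F (fun p : Z * Z => l (mdist p.1 p.2)) m1 m2)%E.
  apply: le_ereal_inf_tmp => _ [gamma _ <-].
  apply: adde_ge0; first by apply: adde_ge0; exact: divergence_ge0.
  by apply: integral_ge0 => p _; apply: l0; exact: mdist_ge0.
apply: gt0_ler_poweR; rewrite ?in_itv /= ?ET_ge0 ?leey ?(ltW a0) //.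
exact: (ET_isometry hF sF l0 cl hf E1 E2).
Qed.

(** Measures agreeing on Borel sets need not be equal as terms; the identity, an isometry, gives
    both inequalities. *)
Lemma eq_DET (X : polishMetricType R) (mu1 mu2 nu1 nu2 : finmeas R X) :
  (forall B : set (borel X), measurable B -> nu1 B = mu1 B) ->
  (forall B : set (borel X), measurable B -> nu2 B = mu2 B) ->
  DET a F l nu1 nu2 = DET a F l mu1 mu2.
Proof.
move=> E1 E2; have hid : isometric_embedding (@id X) by [].
apply/eqP; rewrite eq_le; apply/andP; split; apply: (DET_isometry hid) => // B mB.
- by rewrite E1.
- by rewrite E2.
Qed.

Lemma SturmET_ge0 (X1 X2 : mmspace R) : (0 <= SturmET a F l X1 X2)%E.
Proof.
by apply: le_ereal_inf_tmp => _ [Y [p1 [p2 [h1 [h2 ->]]]]]; exact: poweR_ge0.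
Qed.

Lemma SturmET_le_DET (X1 X2 : mmspace R) (Y : polishMetricType R)
    (i1 : X1 -> Y) (i2 : X2 -> Y)
    (h1 : isometric_embedding i1) (h2 : isometric_embedding i2) :
  (SturmET a F l X1 X2 <=
   DET a F l (push (isometric_continuous h1) (mm_measure X1))
             (push (isometric_continuous h2) (mm_measure X2)))%E.
Proof.
pose psi1 (s : supp (mm_measure X1)) := i1 (set_val s).
pose psi2 (s : supp (mm_measure X2)) := i2 (set_val s).
have hp1 : isometric_embedding psi1 by move=> s t; rewrite h1.
have hp2 : isometric_embedding psi2 by move=> s t; rewrite h2.
rewrite -(@eq_DET _ _ _ (push_supp (isometric_continuous hp1))
    (push_supp (isometric_continuous hp2))).
- by apply: ereal_inf_lbound; exists Y, psi1, psi2, hp1, hp2.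
- by move=> B mB; apply: (measure_image_supp (isometric_continuous h1)).
- by move=> B mB; apply: (measure_image_supp (isometric_continuous h2)).
Qed.

(** The Sturm distance embeds the supports only, whereas [weak_mG_cvg] embeds the whole spaces, as
    is done here. *)
Record common_space (X1 X2 : mmspace R) := CommonSpace {
  common :> polishMetricType R ;
  common1 : X1 -> common ;
  common2 : X2 -> common ;
  common1_isometric : isometric_embedding common1 ;
  common2_isometric : isometric_embedding common2 }.

Definition common_DET (X1 X2 : mmspace R) (Z : common_space X1 X2) : \bar R :=
  DET a F l
    (push (isometric_continuous (@common1_isometric _ _ Z)) (mm_measure X1))
    (push (isometric_continuous (@common2_isometric _ _ Z)) (mm_measure X2)).

Lemma DET_common_le_SturmET (X1 X2 : mmspace R) (e : R) : 0 < e ->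
  exists Z : common_space X1 X2, (common_DET Z <= SturmET a F l X1 X2 + e%:E)%E.
Proof.
move=> e0; have S0 := SturmET_ge0 X1 X2.
(* The strict inequality used to pick [Y] needs a finite value. For an infinite one any common space
   will do, such as the gluing along the empty set. *)
have [Soo|Sfin] := eqVneq (SturmET a F l X1 X2) +oo%E.
  have hpt : isometric_embedding (fun _ : (set0 : set X1) => (point : X2)).
    by move=> s; have := set_valP s.
  have [Z [j1 [j2 [h1 h2 _]]]] := glue2 hpt.
  by exists (CommonSpace h1 h2); rewrite Soo leey.
have : (SturmET a F l X1 X2 < SturmET a F l X1 X2 + e%:E)%E.
  by rewrite lteDl ?lte_fin // ge0_fin_numE // lt_neqAle Sfin leey.
move=> /ereal_inf_lt[_ [Y [psi1 [psi2 [h1 [h2 ->]]]]] Ylt].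
(* [W] joins [X1] to [Y] along the first support, and [Z] joins [X2] to [W] along the second. The
   distance reached in [Y] can only decrease under [kW \o jY]. *)
have [W [jX1 [jY [hX1 hY jXY]]]] := glue2 h1.
have hYpsi2 : isometric_embedding (jY \o psi2) by move=> s t /=; rewrite hY h2.
have [Z [kX2 [kW [hX2 hW kXW]]]] := glue2 hYpsi2.
have hkX1 : isometric_embedding (kW \o jX1) by move=> s t /=; rewrite hW hX1.
have hkY : isometric_embedding (kW \o jY) by move=> s t /=; rewrite hW hY.
exists (CommonSpace hkX1 hX2); apply: le_trans (ltW Ylt).
apply: (DET_isometry hkY) => B mB; symmetry.
- apply: (@measure_image_supp _ _ _ (mm_measure X1) (kW \o jX1)
    ((kW \o jY) \o psi1)) => //; last by move=> s /=; rewrite jXY.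
  exact: isometric_continuous.
- apply: (@measure_image_supp _ _ _ (mm_measure X2) kX2
    ((kW \o jY) \o psi2)) => //.
  exact: isometric_continuous.
Qed.

End regular.

Theorem theorem3 (R : realType) (a : R) (F l : R -> \bar R)
    (hreg : regular_ET a F l) (X : nat -> mmspace R) (Xoo : mmspace R) :
  weak_mG_cvg X Xoo <-> (SturmET a F l (X n) Xoo @[n --> \oo] --> 0%E).
Proof.
have Sturm0 n : (0 <= SturmET a F l (X n) Xoo)%E by exact: SturmET_ge0.
have regY (Y : polishMetricType R) := regular_metric hreg Y.
split.
  move=> [Y [i [ioo [h [hoo cvgY]]]]]; have [mY _ _ topY] := regY Y.
  apply/(ereal_cvg0P Sturm0) => e e0.
  set moo := push _ _ in cvgY.
  have : nbhs moo [set nu | (DET a F l moo nu < e%:E)%E] by apply/topY; exists e.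
  move=> /cvgY moo_e; near=> n.
  apply: (le_lt_trans (SturmET_le_DET hreg (h n) hoo)).
  by rewrite (D_sym mY); near: n; exact: moo_e.
move=> /(ereal_cvg0P Sturm0) cvg0.
have einv n : 0 < n.+1%:R^-1 :> R by rewrite invr_gt0 ltr0n.
pose Z n := projT1 (cid (DET_common_le_SturmET hreg (X n) Xoo (einv n))).
have ZP n : (common_DET a F l (Z n) <= SturmET a F l (X n) Xoo + n.+1%:R^-1%:E)%E.
  exact: (projT2 (cid (DET_common_le_SturmET hreg (X n) Xoo (einv n)))).
(* All the [Z n] are glued along their copies of [Xoo]. By [ej] these copies coincide in [Y], so the
   one in [Z 0] can stand for all. *)
have [|Y [j [hj ej]]] := @glue R nat (fun n => Z n) 0 Xoo point
    (fun n => @common2 _ _ _ (Z n)).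
  by move=> k m x y; rewrite !common2_isometric.
have h n : isometric_embedding (j n \o @common1 _ _ _ (Z n)).
  by move=> x y /=; rewrite hj common1_isometric.
have hoo : isometric_embedding (j 0 \o @common2 _ _ _ (Z 0)).
  by move=> x y /=; rewrite hj common2_isometric.
exists Y, (fun n => j n \o @common1 _ _ _ (Z n)), (j 0 \o @common2 _ _ _ (Z 0)).
exists h, hoo; have [mY _ _ topY] := regY Y.
set moo := push _ _; move=> A /topY[e e0 eA].
have e20 : 0 < e / 2 by lra.
suff De : \forall n \near \oo, (DET a F l moo
    (push (isometric_continuous (h n)) (mm_measure (X n))) < e%:E)%E.
  by case: De => N _ NDe; exists N => // n Nn; apply: eA; exact: NDe.
near=> n; rewrite (D_sym mY).
(* The distance in [Y] is at most the one in [Z n], which in turn exceeds the Sturm distance by at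
   most [1/(n+1)]; each of these last two terms is eventually below [e/2]. *)
apply: (@le_lt_trans _ _ (common_DET a F l (Z n))).
  apply: (DET_isometry hreg (hj n)) => // B mB.
  rewrite -[LHS]/(mm_measure Xoo ((j 0 \o @common2 _ _ _ (Z 0)) @^-1` B)).
  rewrite -[RHS]/(mm_measure Xoo ((j n \o @common2 _ _ _ (Z n)) @^-1` B)).
  by congr (mm_measure Xoo (_ @^-1` B)); apply/funext => x /=; exact: ej.
rewrite (le_lt_trans (ZP n)) // [e]splitr EFinD lteD //; near: n.
  exact: cvg0.
by apply: filterS (near_infty_natSinv_lt (PosNum e20)) => n; rewrite lte_fin.
Unshelve. all: by end_near. Qed.
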